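(* Let the FIE cost function satisfy Assumption A1 stated in the context, and suppose that: a) the system $x_{t+1}=f(x_t,w_t)$, $y_t=h(x_t)+v_t$ is i-IOSS with functions $\beta\in\mathcal{KL}$, $\alpha_1,\alpha_2\in\mathcal K$, where $\beta(s,t)=c_1s^{a_1}(t+1)^{-b_1}$ for some constants $c_1,a_1,b_1>0$ and all $s,t\ge0$; b) the sub-cost function $V_{t,1}$ is $V_{t,1}(\chi_0-\bar x_0)=c_2|\chi_0-\bar x_0|^{a_2}(t+1)^{-b_2}$ with $c_2,a_2,b_2>0$ (so that $\underline\rho_x(s,t)=\rho_x(s,t)=c_2s^{a_2}(t+1)^{-b_2}$); and c) $\frac{a_2}{b_2}\ge\frac{a_1}{b_1}$. Let $\eta\in(0,1)$ and $M_0,M_w,M_v\ge0$. Then there exist $\bar\beta_x\in\mathcal{KL}$ and $\bar\alpha_w,\bar\alpha_v\in\mathcal K$ satisfying the inequality of Assumption A2 stated in the context such that, with $\bar s$ the resulting constant defined in the context, the following holds: if $$c_1\left[3\left(1+\sqrt[a_2]{3}\right)\right]^{a_1}s^{a_1}(T_{\eta,\bar s}+1)^{-b_1}+\alpha_1\left(3\underline\gamma_w^{-1}\left(3c_2s^{a_2}(T_{\eta,\bar s}+1)^{-b_2}\right)\right)+\alpha_2\left(3\underline\gamma_v^{-1}\left(3c_2s^{a_2}(T_{\eta,\bar s}+1)^{-b_2}\right)\right)\le\eta s$$ for all $s\in[0,\bar s]$, then $$\bar\beta_x(s,T_{\eta,\bar s})+\alpha_1\left(3\underline\gamma_w^{-1}\left(3\rho_x(s,T_{\eta,\bar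 s})\right)\right)+\alpha_2\left(3\underline\gamma_v^{-1}\left(3\rho_x(s,T_{\eta,\bar s})\right)\right)\le\eta s$$ for all $s\in[0,\bar s]$.
   Context: Notation. $\mathbb I_{\ge0}$ is the set of nonnegative integers, $\mathbb I_{a:b}$ the integers from $a$ to $b$; for discrete times, $t\ge0$ and $t\in\mathbb I_{\ge0}$ are used interchangeably; $T_{\eta,\bar s}\in\mathbb I_{\ge0}$ is a horizon size. $|\cdot|$ is the Euclidean norm. $\boldsymbol x_{a:b}$ denotes $\{x_a,\dots,x_b\}$, $h(\boldsymbol x_{a:b})=\{h(x_a),\dots,h(x_b)\}$, and $\|\boldsymbol x_{a:b}\|:=\max_{a\le i\le b}|x_i|$ if $a\le b$, $0$ if $a>b$. $\alpha:\mathbb R_{\ge0}\to\mathbb R_{\ge0}$ is a $\mathcal K$ function if continuous, zero at zero and strictly increasing, and $\mathcal K_\infty$ if moreover $\alpha(s)\to\infty$ as $s\to\infty$. $\varphi:\mathbb R_{\ge0}\to\mathbb R_{\ge0}$ is an $\mathcal L$ function if continuous, nonincreasing and $\varphi(t)\to0$ as $t\to\infty$. $\beta:\mathbb R_{\ge0}^2\to\mathbb R_{\ge0}$ is a $\mathcal{KL}$ function if $\beta(\cdot,t)\in\mathcal K$ for each $t\ge0$ and $\beta(s,\cdot)\in\mathcal L$ for each $s\ge0$. System. $x_{t+1}=f(x_t,w_t)$, $y_t=h(x_t)+v_t$, $x_t\in\mathbb R^n$, $y_t,v_t\in\mathbb R^p$, $w_t\in\mathbb R^g$, $f,h$ continuous.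 It is i-IOSS if there exist $\beta\in\mathcal{KL}$, $\alpha_1,\alpha_2\in\mathcal K$ such that for all initial states $x_0^{(1)},x_0^{(2)}$ and disturbance sequences $\boldsymbol w^{(1)}_{0:t-1},\boldsymbol w^{(2)}_{0:t-1}$, with corresponding states $x_t^{(i)}$ of $x_{t+1}=f(x_t,w_t)$, for all $t\in\mathbb I_{\ge0}$: $|x_t^{(1)}-x_t^{(2)}|\le\beta(|x_0^{(1)}-x_0^{(2)}|,t)+\alpha_1(\|\boldsymbol w^{(1)}_{0:t-1}-\boldsymbol w^{(2)}_{0:t-1}\|)+\alpha_2(\|h(\boldsymbol x^{(1)}_{0:t})-h(\boldsymbol x^{(2)}_{0:t})\|)$. Full information estimation (FIE) minimizes a cost $V_t(\chi_0-\bar x_0,\boldsymbol\omega_{0:t-1},\boldsymbol\nu_{0:t})$ over initial states $\chi_0\in\mathbb B_x^0$, disturbances $\boldsymbol\omega_{0:t-1}\in\mathbb B_w^{0:t-1}$ and noises $\boldsymbol\nu_{0:t}\in\mathbb B_v^{0:t}$ (given bounded sets) subject to $\chi_{\tau+1}=f(\chi_\tau,\omega_\tau)$ and $y_\tau=h(\chi_\tau)+\nu_\tau$; $\bar x_0$ is a prior estimate of $x_0$. Assumption A1. $V_t=V_{t,1}(\chi_0-\bar x_0)+V_{t,2}(\boldsymbol\omega_{0:t-1},\boldsymbol\nu_{0:t})$ with $V_{t,1},V_{t,2}$ continuous and, for all $\chi_0\in\mathbb B_x^0$, $\boldsymbol\omega_{0:t-1}\in\mathbb B_w^{0:t-1}$,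 $\boldsymbol\nu_{0:t}\in\mathbb B_v^{0:t}$, $t\in\mathbb I_{\ge0}$: $\underline\rho_x(|\chi_0-\bar x_0|,t)\le V_{t,1}(\chi_0-\bar x_0)\le\rho_x(|\chi_0-\bar x_0|,t)$ and $\underline\gamma_w(\|\boldsymbol\omega_{0:t-1}\|)+\underline\gamma_v(\|\boldsymbol\nu_{0:t}\|)\le V_{t,2}(\boldsymbol\omega_{0:t-1},\boldsymbol\nu_{0:t})\le\gamma_w(\|\boldsymbol\omega_{0:t-1}\|)+\gamma_v(\|\boldsymbol\nu_{0:t}\|)$, where $\underline\rho_x,\rho_x\in\mathcal{KL}$ and $\underline\gamma_w,\underline\gamma_v,\gamma_w,\gamma_v\in\mathcal K_\infty$. Assumption A2 (inequality). For all $s_x,s_w,s_v,t\ge0$: $\beta\left(s_x+\underline\rho_x^{-1}\left(\rho_x(s_x,t)+\gamma_w(s_w)+\gamma_v(s_v),t\right),t\right)\le\bar\beta_x(s_x,t)+\bar\alpha_w(s_w)+\bar\alpha_v(s_v)$, where $\underline\rho_x^{-1}(\cdot,t)$ is the inverse of $\underline\rho_x(\cdot,t)$ in its first argument at time $t$. Constant $\bar s$. $M_0,M_w,M_v$ are bounds with $|x_0-\bar x_0|\le M_0$, $|w_t|\le M_w$, $|v_t|\le M_v$ for all $t$, and $\bar s:=\beta_x(M_0,0)+\frac1{1-\eta}(\alpha_w(M_w)+\alpha_v(M_v))$ with $\beta_x(s,t)=\bar\beta_x(s,t)+\alpha_1(3\underline\gamma_w^{-1}(3\rho_x(s,t)))+\alpha_2(3\underline\gamma_v^{-1}(3\rho_x(s,t)))$,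 $\alpha_w(s)=\bar\alpha_w(s)+\alpha_1(3s+3\underline\gamma_w^{-1}(3\gamma_w(s)))+\alpha_2(3\underline\gamma_v^{-1}(3\gamma_w(s)))$, $\alpha_v(s)=\bar\alpha_v(s)+\alpha_1(3\underline\gamma_w^{-1}(3\gamma_v(s)))+\alpha_2(3s+3\underline\gamma_v^{-1}(3\gamma_v(s)))$. *)

(* Defs.v *)
From HB Require Import structures.
From mathcomp Require Import all_boot all_order all_algebra.
From mathcomp Require Import all_classical all_reals all_analysis.

Set Implicit Arguments.
Unset Strict Implicit.
Unset Printing Implicit Defensive.

Import Order.TTheory GRing.Theory Num.Theory.
Import numFieldNormedType.Exports.

Local Open Scope classical_set_scope.
Local Open Scope ring_scope.

(* A function on the nonnegative reals is a function [R -> R] of which only the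
   restriction to [0, +oo[ matters; a finite sequence of m vectors of R^k is an
   m x k matrix whose rows are the vectors. *)

Definition classK (R : realType) (alpha : R -> R) : Prop :=
  [/\ forall s : R, 0 <= s -> 0 <= alpha s,
      {within `[0, +oo[, continuous alpha},
      alpha 0 = 0 &
      forall s1 s2 : R, 0 <= s1 -> s1 < s2 -> alpha s1 < alpha s2].

Definition classKoo (R : realType) (alpha : R -> R) : Prop :=
  classK alpha /\ alpha s @[s --> +oo] --> +oo.

Definition classL (R : realType) (phi : R -> R) : Prop :=
  [/\ forall t : R, 0 <= t -> 0 <= phi t,
      {within `[0, +oo[, continuous phi},
      forall t1 t2 : R, 0 <= t1 -> t1 <= t2 -> phi t2 <= phi t1 &
      phi t @[t --> +oo] --> 0].

Definition classKL (R : realType) (beta : R -> R -> R) : Prop :=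
  (forall t : R, 0 <= t -> classK (fun s => beta s t)) /\
  (forall s : R, 0 <= s -> classL (fun t => beta s t)).

Definition inv_nneg (R : realType) (alpha : R -> R) : R -> R :=
  pinv (`[0, +oo[ : set R) alpha.

(* The library norm on matrices is the sup norm, hence this definition. *)
Definition enorm (R : realType) (k : nat) (x : 'rV[R]_k) : R :=
  Num.sqrt (\sum_(j < k) x 0 j ^+ 2).

Definition seqnorm (R : realType) (m k : nat) (u : 'M[R]_(m, k)) : R :=
  \big[Num.max/0]_(i < m) enorm (row i u).

Fixpoint traj (R : realType) (n g : nat) (f : 'rV[R]_n * 'rV[R]_g -> 'rV[R]_n)
    (x0 : 'rV[R]_n) (w : nat -> 'rV[R]_g) (t : nat) : 'rV[R]_n :=
  if t is t'.+1 then f (traj f x0 w t', w t') else x0.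

Definition i_IOSS (R : realType) (n p g : nat)
    (f : 'rV[R]_n * 'rV[R]_g -> 'rV[R]_n) (h : 'rV[R]_n -> 'rV[R]_p)
    (beta : R -> R -> R) (alpha1 alpha2 : R -> R) : Prop :=
  [/\ classKL beta, classK alpha1, classK alpha2 &
    forall (x1 x2 : 'rV[R]_n) (w1 w2 : nat -> 'rV[R]_g) (t : nat),
      enorm (traj f x1 w1 t - traj f x2 w2 t) <=
        beta (enorm (x1 - x2)) t%:R
        + alpha1 (seqnorm (\matrix_(i < t) (w1 i - w2 i)))
        + alpha2 (seqnorm (\matrix_(i < t.+1)
            (h (traj f x1 w1 i) - h (traj f x2 w2 i))))].

Definition bounded_seqs (R : realType) (m k : nat) (B : set 'M[R]_(m, k)) :
    Prop :=
  exists M : R, forall u, B u -> seqnorm u <= M.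

(* [Bw t] and [Bv t] are the sets of admissible disturbance and noise sequences
   for the estimation problem at time t; products of sets, one for each
   instant, are a special case. *)
Record FIE_cost_bounds (R : realType) (n p g : nat) (xbar0 : 'rV[R]_n)
    (Bx : set 'rV[R]_n)
    (Bw : forall t : nat, set 'M[R]_(t, g))
    (Bv : forall t : nat, set 'M[R]_(t.+1, p))
    (V : forall t : nat, 'rV[R]_n -> 'M[R]_(t, g) -> 'M[R]_(t.+1, p) -> R)
    (V1 : nat -> 'rV[R]_n -> R)
    (V2 : forall t : nat, 'M[R]_(t, g) -> 'M[R]_(t.+1, p) -> R)
    (rho_lo rho_up : R -> R -> R)
    (gw_lo gv_lo gw_up gv_up : R -> R) : Prop := FIECostBounds {
  cost_split : forall t z omega nu, V t z omega nu = V1 t z + V2 t omega nu;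
  cost_cont1 : forall t, continuous (V1 t);
  cost_cont2 : forall t, continuous
    (fun u : 'M[R]_(t, g) * 'M[R]_(t.+1, p) => V2 t u.1 u.2);
  cost_rho_lo : classKL rho_lo;
  cost_rho_up : classKL rho_up;
  cost_gw_lo : classKoo gw_lo;
  cost_gv_lo : classKoo gv_lo;
  cost_gw_up : classKoo gw_up;
  cost_gv_up : classKoo gv_up;
  cost_bound1 : forall t chi0, Bx chi0 ->
    rho_lo (enorm (chi0 - xbar0)) t%:R <= V1 t (chi0 - xbar0)
      <= rho_up (enorm (chi0 - xbar0)) t%:R;
  cost_bound2 : forall t omega nu, Bw t omega -> Bv t nu ->
    gw_lo (seqnorm omega) + gv_lo (seqnorm nu) <= V2 t omega nu
      <= gw_up (seqnorm omega) + gv_up (seqnorm nu) }.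

Definition gain_ineq (R : realType) (beta rho_lo rho_up : R -> R -> R)
    (gw_up gv_up : R -> R) (bbx : R -> R -> R) (baw bav : R -> R) : Prop :=
  forall sx sw sv t : R, 0 <= sx -> 0 <= sw -> 0 <= sv -> 0 <= t ->
    beta (sx + inv_nneg (fun s => rho_lo s t)
                 (rho_up sx t + gw_up sw + gv_up sv)) t
    <= bbx sx t + baw sw + bav sv.

Definition beta_x (R : realType) (rho_up : R -> R -> R)
    (alpha1 alpha2 gw_lo gv_lo : R -> R) (bbx : R -> R -> R) (s t : R) : R :=
  bbx s t + alpha1 (3 * inv_nneg gw_lo (3 * rho_up s t))
          + alpha2 (3 * inv_nneg gv_lo (3 * rho_up s t)).

Definition alpha_w (R : realType) (alpha1 alpha2 gw_lo gv_lo gw_up : R -> R)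
    (baw : R -> R) (s : R) : R :=
  baw s + alpha1 (3 * s + 3 * inv_nneg gw_lo (3 * gw_up s))
        + alpha2 (3 * inv_nneg gv_lo (3 * gw_up s)).

Definition alpha_v (R : realType) (alpha1 alpha2 gw_lo gv_lo gv_up : R -> R)
    (bav : R -> R) (s : R) : R :=
  bav s + alpha1 (3 * inv_nneg gw_lo (3 * gv_up s))
        + alpha2 (3 * s + 3 * inv_nneg gv_lo (3 * gv_up s)).

Definition sbar (R : realType) (rho_up : R -> R -> R)
    (alpha1 alpha2 gw_lo gv_lo gw_up gv_up : R -> R)
    (bbx : R -> R -> R) (baw bav : R -> R) (eta M0 Mw Mv : R) : R :=
  beta_x rho_up alpha1 alpha2 gw_lo gv_lo bbx M0 0
  + (1 - eta)^-1 * (alpha_w alpha1 alpha2 gw_lo gv_lo gw_up baw Mw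
                    + alpha_v alpha1 alpha2 gw_lo gv_lo gv_up bav Mv).

(* Main.v *)
(* The time-t inverse of rho_lo rescales the disturbance terms gw, gv by the
   factor (t + 1)^(b2/a2). Splitting the powers with
   (x + y + z)^a <= 3^a (x^a + y^a + z^a), the disturbance terms appear in beta
   with the factor (t + 1)^(b2/a2 * a1 - b1), which is at most 1 by the
   condition a1/b1 <= a2/b2, while the initial error keeps the decay of beta.
   The two inequalities on the horizon then coincide, since bbx is exactly the
   first term of the hypothesis. *)

Require Import Defs.
From HB Require Import structures.
From mathcomp Require Import all_boot all_order all_algebra.
From mathcomp Require Import all_classical all_reals all_analysis.
From mathcomp Require Import ring lra.

Import Order.TTheory GRing.Theory Num.Theory.
Import numFieldNormedType.Exports.

Local Open Scope classical_set_scope.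
Local Open Scope ring_scope.

Lemma classK_powR (R : realType) (a : R) : 0 < a -> classK (fun s => s `^ a).
Proof.
move=> a0; split=> [s _||| s1 s2 s10 s12]; first exact: powR_ge0.
(* Derivability gives continuity only at positive points; at 0 the right limit is taken
   separately. *)
- apply/continuous_within_itvcyP; split=> [x|].
    move=> x0; apply: differentiable_continuous.
    by apply/derivable1_diffP; exact: derivable_powR.
  by rewrite powR0 ?gt_eqF//; exact: powR_cvg0.
- by rewrite powR0 ?gt_eqF.
- by apply: gt0_ltr_powR => //; rewrite nnegrE// ltW// (le_lt_trans s10).
Qed.

Lemma classK_comp (R : realType) (f g : R -> R) :
  classK f -> classK g -> classK (fun s => f (g s)).
Proof.
move=> [f0 fc f00 fi] [g0 gc g00 gi]; split=> [s s0|||s1 s2 s10 s12].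
- exact/f0/g0.
- move/subspace_continuousP in fc; move/subspace_continuousP in gc.
  (* Continuity of [f] is relative to the half-line, so it applies along [g] only because [g] keeps
     its values there. *)
  have gA x : `[0, +oo[%classic x -> `[0, +oo[%classic (g x).
    by rewrite /= !in_itv/= !andbT; exact: g0.
  apply/subspace_continuousP => x Ax.
  apply: (cvg_comp _ _ _ (fc _ (gA _ Ax))) => U gxU.
  have := gc _ Ax _ gxU; rewrite /= !nbhs_simpl/= => gU.
  by near=> y; apply: (near gU y) => //; apply: gA; near: y; exact: withinT.
- by rewrite g00.
- by apply: fi; [exact: g0|exact: gi].
Unshelve. all: by end_near. Qed.

Lemma classK_scale (R : realType) (k : R) (f : R -> R) :
  0 < k -> classK f -> classK (fun s => k * f s).
Proof.
move=> k0 [f0 fc f00 fi]; split=> [s s0|||s1 s2 s10 s12].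
- by rewrite mulr_ge0 ?f0// ltW.
- by move=> x; apply: cvgM; [exact: cvg_cst|exact: fc].
- by rewrite f00 mulr0.
- by rewrite ltr_pM2l// fi.
Qed.

Lemma classL_scale (R : realType) (k : R) (f : R -> R) :
  0 < k -> classL f -> classL (fun t => k * f t).
Proof.
move=> k0 [f0 fc fi fl]; split=> [s s0||t1 t2 t10 t12|].
- by rewrite mulr_ge0 ?f0// ltW.
- by move=> x; apply: cvgM; [exact: cvg_cst|exact: fc].
- by rewrite ler_pM2l// fi.
- by rewrite -(mulr0 k); apply: cvgM; [exact: cvg_cst|exact: fl].
Qed.

Lemma classKL_scale (R : realType) (k : R) (b : R -> R -> R) :
  0 < k -> classKL b -> classKL (fun s t => k * b s t).
Proof.
by move=> k0 [bK bL]; split=> [t t0|s s0];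
  [apply: classK_scale => //; exact: bK|apply: classL_scale => //; exact: bL].
Qed.

(** Strict monotonicity makes [alpha] injective on the half-line, where [pinv] then cancels it on
    the left. *)
Lemma inv_nnegK (R : realType) (alpha : R -> R) (s : R) :
  classK alpha -> 0 <= s -> inv_nneg alpha (alpha s) = s.
Proof.
move=> [_ _ _ ai] s0; apply: pinvKV; last first.
  by rewrite inE/= in_itv/= andbT.
move=> x y; rewrite !inE/= !in_itv/= !andbT => x0 y0 axy.
case: (ltgtP x y) => // [xy|yx].
  by have := ai _ _ x0 xy; rewrite axy ltxx.
by have := ai _ _ y0 yx; rewrite axy ltxx.
Qed.

(** The sum is at most three times the largest term, whose power is one of the three on the right.
    This avoids convexity, so exponents below 1 are covered too. *)
Lemma powR_add3_le (R : realType) (a x y z : R) :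
  0 <= a -> 0 <= x -> 0 <= y -> 0 <= z ->
  (x + y + z) `^ a <= 3 `^ a * (x `^ a + y `^ a + z `^ a).
Proof.
move=> a0 x0 y0 z0; set m := Num.max x (Num.max y z).
have m0 : 0 <= m by rewrite le_max x0.
apply: (@le_trans _ _ ((3 * m) `^ a)).
  apply: ge0_ler_powR; rewrite ?nnegrE ?mulr_ge0 ?addr_ge0//.
  have : [/\ x <= m, y <= m & z <= m] by rewrite !le_max !lexx !orbT.
  by case; lra.
rewrite powRM// ler_wpM2l ?powR_ge0//.
have := powR_ge0 x a; have := powR_ge0 y a; have := powR_ge0 z a.
by rewrite /m /Num.max; case: ifP => _; [case: ifP => _|]; lra.
Qed.

(** The right-hand side is a nonnegative preimage of [y], so [inv_nnegK] identifies it with the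
    inverse. *)
Lemma inv_nneg_power (R : realType) (rho : R -> R -> R) (c a b : R)
    (c0 : 0 < c) (a0 : 0 < a)
    (rhoE : forall s t, 0 <= s -> 0 <= t ->
       rho s t = c * s `^ a * (t + 1) `^ (- b))
    (y t : R) :
  classK (fun s => rho s t) -> 0 <= t -> 0 <= y ->
  inv_nneg (fun s => rho s t) y = (y / c * (t + 1) `^ b) `^ a^-1.
Proof.
move=> rK t0 y0; have t1 : 0 < t + 1 by lra.
rewrite -[in LHS](_ : rho ((y / c * (t + 1) `^ b) `^ a^-1) t = y).
  by rewrite (inv_nnegK _ _ _ rK)// powR_ge0.
rewrite rhoE ?powR_ge0// -powRrM mulVf ?gt_eqF// powRr1; last first.
  by rewrite mulr_ge0 ?powR_ge0// divr_ge0// ltW.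
rewrite powRN; have : (t + 1) `^ b != 0 by rewrite gt_eqF// powR_gt0.
by move: (_ `^ _) => u u0; field; rewrite u0 gt_eqF.
Qed.

(** This is the gain inequality without the factor [c1]: [u] stands for [t + 1], and [w], [v] for
    the disturbance terms divided by [c2]. *)
Lemma power_gain_le (R : realType) (a1 b1 a2 b2 s w v u : R) :
  0 < a1 -> 0 < b1 -> 0 < a2 -> 0 < b2 -> a1 / b1 <= a2 / b2 ->
  0 <= s -> 0 <= w -> 0 <= v -> 1 <= u ->
  (s + (s `^ a2 + w * u `^ b2 + v * u `^ b2) `^ a2^-1) `^ a1 * u `^ (- b1) <=
  (3 * (1 + 3 `^ a2^-1)) `^ a1 * s `^ a1 * u `^ (- b1)
  + (3 * 3 `^ a2^-1 * w `^ a2^-1) `^ a1 + (3 * 3 `^ a2^-1 * v `^ a2^-1) `^ a1.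
Proof.
move=> a10 b10 a20 b20 ratio s0 w0 v0 u1.
have u0 : 0 < u by lra.
set q := 3 `^ a2^-1; have q0 : 0 <= q := powR_ge0 _ _.
set W := w `^ a2^-1; have W0 : 0 <= W := powR_ge0 _ _.
set Z := v `^ a2^-1; have Z0 : 0 <= Z := powR_ge0 _ _.
set r := u `^ (b2 / a2); have r0 : 0 <= r := powR_ge0 _ _.
have decay : r `^ a1 * u `^ (- b1) <= 1.
  rewrite /r -powRrM -powRD; last by rewrite (gt_eqF u0) implybT.
  (* With 1 written as [u] to the power 0 and [1 <= u], it remains to compare exponents, which is
     [ratio] with denominators cleared. *)
  rewrite -(powRr0 u); apply: ler_powR => //.
  move: ratio; rewrite ler_pdivrMr// mulrAC ler_pdivlMr// => ratio.
  by rewrite mulrAC subr_le0 ler_pdivrMr// mulrC (mulrC b1).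
have root_le : (s `^ a2 + w * u `^ b2 + v * u `^ b2) `^ a2^-1
    <= q * (s + W * r + Z * r).
  apply: le_trans (powR_add3_le _ _ _ _ _ _ _ _ _) _;
    rewrite ?mulr_ge0 ?powR_ge0 ?invr_ge0 ?(ltW a20)//.
  by rewrite !powRM ?powR_ge0// -!powRrM divff ?gt_eqF// powRr1.
(* The outer [s] and the [q * s] coming from the root merge into [(1 + q) * s], so one more
   three-term split suffices. *)
have step : (s + (s `^ a2 + w * u `^ b2 + v * u `^ b2) `^ a2^-1) `^ a1
    <= 3 `^ a1 * (((1 + q) * s) `^ a1 + (q * W * r) `^ a1 + (q * Z * r) `^ a1).
  apply: le_trans (powR_add3_le _ _ _ _ _ _ _ _ _);
    rewrite ?mulr_ge0 ?addr_ge0 ?(ltW a10)//.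
  apply: ge0_ler_powR; rewrite ?nnegrE ?(ltW a10)//.
  - by rewrite addr_ge0 ?powR_ge0.
  - by rewrite !addr_ge0 ?mulr_ge0 ?addr_ge0.
  by move: root_le; lra.
apply: le_trans (ler_wpM2r (powR_ge0 u (- b1)) step) _.
rewrite !(powRM a1) ?mulr_ge0 ?addr_ge0//.
set e := u `^ (- b1) in decay *.
set A := 3 `^ a1; set B := q `^ a1; set C := r `^ a1 in decay *.
set P := W `^ a1; set Q := Z `^ a1.
(* The product [C * e], at most 1 by [decay], is isolated in the disturbance terms. *)
rewrite [leLHS](_ : _ = A * (1 + q) `^ a1 * s `^ a1 * e
  + A * B * P * (C * e) + A * B * Q * (C * e)); last by ring.
by rewrite !lerD// ler_piMr// !mulr_ge0 ?powR_ge0.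
Qed.

Theorem lemma8 (R : realType) (n p g : nat)
    (f : 'rV[R]_n * 'rV[R]_g -> 'rV[R]_n) (h : 'rV[R]_n -> 'rV[R]_p)
    (f_cont : continuous f) (h_cont : continuous h)
    (xbar0 : 'rV[R]_n)
    (Bx : set 'rV[R]_n)
    (Bw : forall t : nat, set 'M[R]_(t, g))
    (Bv : forall t : nat, set 'M[R]_(t.+1, p))
    (Bx_bounded : exists M : R, forall x, Bx x -> enorm x <= M)
    (Bw_bounded : forall t, bounded_seqs (Bw t))
    (Bv_bounded : forall t, bounded_seqs (Bv t))
    (V : forall t : nat, 'rV[R]_n -> 'M[R]_(t, g) -> 'M[R]_(t.+1, p) -> R)
    (V1 : nat -> 'rV[R]_n -> R)
    (V2 : forall t : nat, 'M[R]_(t, g) -> 'M[R]_(t.+1, p) -> R)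
    (rho_lo rho_up : R -> R -> R) (gw_lo gv_lo gw_up gv_up : R -> R)
    (V_bounds : FIE_cost_bounds xbar0 Bx Bw Bv V V1 V2
                  rho_lo rho_up gw_lo gv_lo gw_up gv_up)
    (beta : R -> R -> R) (alpha1 alpha2 : R -> R)
    (ioss : i_IOSS f h beta alpha1 alpha2)
    (c1 a1 b1 : R) (c1_gt0 : 0 < c1) (a1_gt0 : 0 < a1) (b1_gt0 : 0 < b1)
    (betaE : forall s t : R, 0 <= s -> 0 <= t ->
       beta s t = c1 * s `^ a1 * (t + 1) `^ (- b1))
    (c2 a2 b2 : R) (c2_gt0 : 0 < c2) (a2_gt0 : 0 < a2) (b2_gt0 : 0 < b2)
    (V1E : forall (t : nat) (chi0 : 'rV[R]_n),
       V1 t (chi0 - xbar0) =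
         c2 * enorm (chi0 - xbar0) `^ a2 * (t%:R + 1) `^ (- b2))
    (rho_loE : forall s t : R, 0 <= s -> 0 <= t ->
       rho_lo s t = c2 * s `^ a2 * (t + 1) `^ (- b2))
    (rho_upE : forall s t : R, 0 <= s -> 0 <= t ->
       rho_up s t = c2 * s `^ a2 * (t + 1) `^ (- b2))
    (ratio : a1 / b1 <= a2 / b2)
    (eta : R) (eta_gt0 : 0 < eta) (eta_lt1 : eta < 1)
    (M0 Mw Mv : R) (M0_ge0 : 0 <= M0) (Mw_ge0 : 0 <= Mw) (Mv_ge0 : 0 <= Mv) :
  exists (bbx : R -> R -> R) (baw bav : R -> R),
    [/\ classKL bbx, classK baw, classK bav,
      gain_ineq beta rho_lo rho_up gw_up gv_up bbx baw bav &
      let sb := sbar rho_up alpha1 alpha2 gw_lo gv_lo gw_up gv_up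
                  bbx baw bav eta M0 Mw Mv in
      forall T : nat,
        (forall s : R, 0 <= s <= sb ->
           c1 * (3 * (1 + 3 `^ a2^-1)) `^ a1 * s `^ a1
             * (T%:R + 1) `^ (- b1)
           + alpha1 (3 * inv_nneg gw_lo
               (3 * (c2 * s `^ a2 * (T%:R + 1) `^ (- b2))))
           + alpha2 (3 * inv_nneg gv_lo
               (3 * (c2 * s `^ a2 * (T%:R + 1) `^ (- b2))))
           <= eta * s) ->
        (forall s : R, 0 <= s <= sb ->
           bbx s T%:R
           + alpha1 (3 * inv_nneg gw_lo (3 * rho_up s T%:R))
           + alpha2 (3 * inv_nneg gv_lo (3 * rho_up s T%:R))
           <= eta * s)].
Proof.
have [betaKL _ _ _] := ioss.
have loKL := cost_rho_lo V_bounds.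
have gw_upK : classK gw_up by have [] := cost_gw_up V_bounds.
have gv_upK : classK gv_up by have [] := cost_gv_up V_bounds.
set q := 3 `^ a2^-1.
have q_gt0 : 0 < q by apply: powR_gt0.
(* [c1] times a disturbance term of [power_gain_le], taken at [gam s / c2]. *)
pose gain (gam : R -> R) (s : R) :=
  c1 * (3 * q * (c2^-1 * gam s) `^ a2^-1) `^ a1.
have gainK gam : classK gam -> classK (gain gam).
  move=> gamK; apply: classK_scale => //.
  apply: (classK_comp _ (fun s => s `^ a1)); first exact: classK_powR.
  apply: classK_scale; first by rewrite mulr_gt0.
  apply: (classK_comp _ (fun s => s `^ a2^-1)).
    by apply: classK_powR; rewrite invr_gt0.
  by apply: classK_scale; rewrite ?invr_gt0.
pose k := (3 * (1 + q)) `^ a1.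
have k_gt0 : 0 < k by rewrite powR_gt0// mulr_gt0// addr_gt0.
(* As a multiple of [beta], rather than an explicit formula, the first witness inherits class KL
   from i-IOSS. *)
exists (fun s t => k * beta s t), (gain gw_up), (gain gv_up); split.
- exact: classKL_scale.
- exact: gainK.
- exact: gainK.
- move=> sx sw sv t sx0 sw0 sv0 t0.
  have gw0 : 0 <= gw_up sw by have [+ _ _ _] := gw_upK; exact.
  have gv0 : 0 <= gv_up sv by have [+ _ _ _] := gv_upK; exact.
  have t1_gt0 : 0 < t + 1 by lra.
  have up0 : 0 <= rho_up sx t.
    by rewrite rho_upE// !mulr_ge0 ?powR_ge0// ltW.
  rewrite (inv_nneg_power _ _ _ _ _ c2_gt0 a2_gt0 rho_loE)//; last 2 first.
  + by have [+ _] := loKL; exact.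
  + by rewrite !addr_ge0.
  rewrite !betaE ?addr_ge0 ?powR_ge0//.
  (* Since [rho_lo] and [rho_up] agree, the rescaling cancels on the initial error and leaves [sx]
     to the power [a2]. *)
  have -> : (rho_up sx t + gw_up sw + gv_up sv) / c2 * (t + 1) `^ b2 =
      sx `^ a2 + c2^-1 * gw_up sw * (t + 1) `^ b2
      + c2^-1 * gv_up sv * (t + 1) `^ b2.
    rewrite rho_upE// powRN.
    have : (t + 1) `^ b2 != 0 by rewrite gt_eqF// powR_gt0.
    by move: ((t + 1) `^ b2) => u u0; field; rewrite u0 gt_eqF.
  have := power_gain_le _ a1 b1 a2 b2 sx (c2^-1 * gw_up sw)
    (c2^-1 * gv_up sv) (t + 1).
  rewrite ler_wpDl// !mulr_ge0 ?invr_ge0 ?(ltW c2_gt0)//.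
  move=> /(_ a1_gt0 b1_gt0 a2_gt0 b2_gt0 ratio sx0 isT isT isT).
  rewrite -/q -/k -(ler_pM2l c1_gt0) => le_gain.
  rewrite -mulrA; apply: le_trans le_gain _.
  by rewrite !mulrDr /gain -!(mulrA k) (mulrCA c1 k) -(mulrA c1).
- move=> sb T hT s /andP[s0 ssb].
  (* Both inequalities range over the same interval, so the hypothesis is used at the same [s]. *)
  have := hT s; rewrite s0 ssb => /(_ isT).
  by rewrite betaE// rho_upE// -/q -/k !mulrA (mulrC c1 k).
Qed.
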